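(* Let $p\in\mathbb Z$ and $q\in\mathbb N^*$ be relatively prime and let $\gamma=2\pi p/q$. For any $\omega\in\mathbb R$ there exists a polynomial $Q_\omega$ of degree $3q$, with real coefficients, depending on $p,q$ (and $\omega$) but not on $(\theta_1,\theta_2)$, such that for all $(\theta_1,\theta_2)\in\mathbb R^2$ and all $\lambda$ $$P_K(\theta_1,\theta_2,\omega,\lambda)=Q_\omega(\lambda)+2\,p^\triangle\big(q(\theta_1+p\pi),q(\theta_2+p\pi)\big)\,R_\omega(\lambda),$$ where $$R_\omega(\lambda)=\Big(\lambda+2\cos\big(3\omega-\tfrac{\gamma}{8}\big)\Big)^q .$$ Moreover the principal (leading) term of $Q_\omega(\lambda)$ is $(-1)^q\lambda^{3q}$.
   Context: Let $p\in\mathbb Z$, $q\in\mathbb N^*$ be relatively prime and $\gamma=2\pi p/q$. The $q\times q$ matrices $J_{p,q}$ and $K_q$ are $J_{p,q}=\mathrm{diag}(e^{i(j-1)\gamma})_{j=1,\dots,q}$ and $(K_q)_{jk}=1$ if $k\equiv j+1 \pmod q$, $0$ otherwise. The kagome (Hou) matrix is the $3q\times3q$ Hermitian matrix $$M_K(\theta_1,\theta_2,\omega)=\begin{pmatrix} 0 & A & B \\ A^* & 0 & C \\ B^* & C^* & 0 \end{pmatrix}$$ with $$A=e^{i(\omega+\gamma/8)}\big(e^{-i\theta_1}J_{p,q}^*+e^{-i\gamma/2}e^{-i(\theta_1-\theta_2)}J_{p,q}^*K_q\big),$$ $$B=e^{-i(\omega+\gamma/8)}\big(e^{-i\theta_1}J_{p,q}^*+e^{-i\theta_2}K_q^*\big),$$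 $$C=e^{i(\omega+\gamma/8)}\big(e^{-i\gamma/2}e^{i(\theta_1-\theta_2)}J_{p,q}K_q^*+e^{-i\theta_2}K_q^*\big).$$ Its characteristic polynomial is $P_K(\theta_1,\theta_2,\omega,\lambda)=\det(M_K(\theta_1,\theta_2,\omega)-\lambda I_{3q})$. The trigonometric polynomial $p^\triangle$ is $p^\triangle(x,\xi)=\cos x+\cos\xi+\cos(x-\xi)$. *)

(* Defs.v *)
From HB Require Import structures.
From mathcomp Require Import all_boot all_order all_algebra.
From mathcomp Require Import complex.
From mathcomp Require Import reals trigo.

Set Implicit Arguments.
Unset Strict Implicit.
Unset Printing Implicit Defensive.

Import Order.TTheory GRing.Theory Num.Theory.

Local Open Scope ring_scope.
Local Open Scope complex_scope.
Local Open Scope sesquilinear_scope.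

Definition expi (R : realType) (t : R) : R[i] := cos t +i* sin t.

Definition flux (R : realType) (p : int) (q : nat) : R :=
  2 * pi * p%:~R / q%:R.

(* Rows and columns are numbered from 0, so the j-th diagonal entry is
   e^{i j gamma} instead of e^{i (j - 1) gamma}. *)
Definition Jmx (R : realType) (p : int) (q : nat) : 'M[R[i]]_q :=
  diag_mx (\row_(j < q) expi (j%:R * flux R p q)).

Definition Kmx (R : realType) (q : nat) : 'M[R[i]]_q :=
  \matrix_(j < q, k < q) (k == j.+1 %[mod q])%:R.

Section Kagome.
Variables (R : realType) (p : int) (q : nat) (th1 th2 w : R).

Local Notation g := (flux R p q).
Local Notation J := (Jmx R p q).
Local Notation K := (Kmx R q).

Definition kagomeA : 'M[R[i]]_q :=
  expi (w + g / 8) *: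
    (expi (- th1) *: J^t*
     + (expi (- (g / 2)) * expi (- (th1 - th2))) *: (J^t* *m K)).

Definition kagomeB : 'M[R[i]]_q :=
  expi (- (w + g / 8)) *: (expi (- th1) *: J^t* + expi (- th2) *: K^t*).

Definition kagomeC : 'M[R[i]]_q :=
  expi (w + g / 8) *:
    ((expi (- (g / 2)) * expi (th1 - th2)) *: (J *m K^t*)
     + expi (- th2) *: K^t*).

Definition kagome_mx : 'M[R[i]]_(q + (q + q)) :=
  block_mx 0 (row_mx kagomeA kagomeB)
           (col_mx (kagomeA^t*) (kagomeB^t*))
           (block_mx 0 kagomeC (kagomeC^t*) 0).

(* Not char_poly, which is \det ('X - M) and differs by the sign (-1)^(3q). *)
Definition kagome_char (l : R[i]) : R[i] := \det (kagome_mx - l%:M).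

End Kagome.

Definition ptri (R : realType) (x xi : R) : R := cos x + cos xi + cos (x - xi).

(* Main.v *)
Require Import Defs.
From mathcomp Require Import all_boot all_order all_algebra.
From mathcomp Require Import fingroup perm complex.
From mathcomp Require Import reals trigo.
From mathcomp Require Import ring lra zify.

Set Implicit Arguments.
Unset Strict Implicit.
Unset Printing Implicit Defensive.

Import Order.TTheory GRing.Theory Num.Theory.

Local Open Scope ring_scope.
Local Open Scope complex_scope.
Local Open Scope sesquilinear_scope.

(** Put X = e^(i th1) J and Y = e^(i th2) K. They form a Weyl pair:
    Y X = zeta X Y with zeta = e^(i gamma) a primitive q-th root of unity.
    Conjugating by the block diagonal unitary diag(X, 1, Y^-1) turns the kagome
    matrix into [hou_mx], whose blocks are first degree expressions in X, Y and
    their inverses, with phases a = e^(i (w + gamma/8)) and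
    c = e^(-i gamma/2).

    Consider the determinant F of the shifted matrix as a function of x when X
    is replaced by x X. Conjugation by Y replaces X by zeta X, so F is invariant
    under x -> zeta x and only powers of x divisible by q occur. Multiplying the
    last block row by x X makes every entry affine in x, so that
    x^q det(X) F(x) is a polynomial in x; transposing the matrix exchanges X, Y
    with their inverse transposes, which gives the same information at
    x = infinity. Hence F(x) is a combination of x^q, 1 and x^-q only
    ([det_hou_expand]).

    The two extreme coefficients are explicit: at x = 0 all blocks are
    polynomials in the single matrix Y, so they commute, and the determinant is
    that of the 3 by 3 determinant over the commutative ring generated by Y and
    its inverse. That determinant factors as (c^-1 + Y) times the scalar
    lambda + a^3 c + a^-3 c^-1 = lambda + 2 cos(3 w - gamma/8). Whence the
    q-th power R in front of the trigonometric part. The remaining factor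
    det(c^-1 + Y) = c^-q + det Y is elementary for a Weyl pair ([det_shift]).

    In this way F minus R times a symmetric sum of six monomials in
    u = c^q det X and v = c^q det Y does not depend on x
    ([det_hou_scale1]). Exchanging the outer two blocks and transposing
    exchanges the roles of X and Y ([det_hou_swap]), so the difference does not
    depend on y either; it is therefore a constant, equal to its value at
    th1 = th2 = 0 ([det_hou_six_terms]). For the matrices J and K one finds
    u = e^(i q (th1 + p pi)), v = e^(i q (th2 + p pi)), where the coprimality of p
    and q fixes the sign of v, and the six monomials add up to 2 ptri
    ([six_terms_expi]).

    The constant is the shifted determinant at th1 = th2 = 0, which is (-1)^q
    times a characteristic polynomial of degree 3 q, minus a multiple of R, of
    degree q < 3 q. It has real coefficients because the kagome matrix is
    Hermitian ([hermitian_char_poly]). *)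

(** * Laurent polynomials invariant under a rotation *)

(** Comparing coefficients of degree k gives P_k z^k = P_k, and z^k = 1 only when
    q divides k. *)
Lemma coef_rotation_invariant (F : fieldType) (q : nat) (z : F) (P : {poly F}) :
  q.-primitive_root z -> P \Po (z *: 'X) = P ->
  forall k, ~~ (q %| k)%N -> P`_k = 0.
Proof.
move=> zq PzP k nqk.
have /eqP : P`_k * z ^+ k = P`_k.
  rewrite -[in RHS]PzP comp_polyE coef_sum.
  under eq_bigr do rewrite exprZn 2!coefZ coefXn mulrA mulr_natr.
  case: (ltnP k (size P)) => [kP | Pk].
    rewrite (bigD1 (Ordinal kP)) //= eqxx mulr1n big1 ?addr0 // => i /negbTE ik.
    by rewrite -val_eqE /= in ik; rewrite eq_sym ik mulr0n.
  rewrite big1 => [|i _]; first by rewrite nth_default ?mul0r.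
  by rewrite gtn_eqF ?mulr0n // (leq_trans (ltn_ord i)).
rewrite -subr_eq0 -{2}[P`_k]mulr1 -mulrBr mulf_eq0 => /orP[/eqP// |].
by rewrite subr_eq0 -(prim_order_dvd zq) (negbTE nqk).
Qed.

Lemma poly_eq_off0 (F : numFieldType) (P Q : {poly F}) :
  (forall x, x != 0 -> P.[x] = Q.[x]) -> P = Q.
Proof.
move=> PQ; apply/eqP; rewrite -subr_eq0.
pose rs : seq F := [seq i.+1%:R | i <- iota 0 (size (P - Q))].
apply/eqP/(@roots_geq_poly_eq0 _ _ rs).
- apply/allP => _ /mapP[i _ ->].
  by rewrite rootE hornerD hornerN PQ ?subrr ?pnatr_eq0.
- rewrite map_inj_in_uniq ?iota_uniq // => i j _ _ /eqP.
  by rewrite eqr_nat eqSS => /eqP.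
- by rewrite size_map size_iota.
Qed.

(** The polynomials D and D' are one Laurent polynomial read at 0 and at infinity:
    D(x) = x^q f(x) and b D'(1/x) = x^-q f(x). The second expression bounds the
    degree of D by 2q and exhibits its top coefficient, and the rotation
    invariance kills every degree except 0, q and 2q. *)
Lemma three_term_laurent (F : numFieldType) (q : nat) (z b : F)
    (D D' : {poly F}) :
  (0 < q)%N -> q.-primitive_root z ->
  (forall x, x != 0 -> D.[z * x] = D.[x]) ->
  (forall x, x != 0 -> D.[x] = b * x ^+ (2 * q) * D'.[x^-1]) ->
  exists m, forall x,
    D.[x] = D.[0] + m * x ^+ q + b * D'.[0] * x ^+ (2 * q).
Proof.
move=> q0 zq Dz DD'.
have cD0 k : ~~ (q %| k)%N -> D`_k = 0.
  apply: (coef_rotation_invariant zq); apply: poly_eq_off0 => x x0.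
  by rewrite horner_comp hornerZ hornerX Dz.
pose n := size D'.
(* The reversal x^n D'(1/x) turns the hypothesis into a polynomial identity. *)
pose rev := \sum_(i < n) D'`_i *: 'X^(n - i) : {poly F}.
have revE : 'X^n * D = b *: ('X^(2 * q) * rev).
  apply: poly_eq_off0 => x x0.
  rewrite hornerM hornerZ hornerM !hornerXn DD' // [LHS]mulrCA -!mulrA.
  congr (_ * (_ * _)).
  rewrite horner_coef horner_sum mulr_sumr; apply: eq_bigr => i _.
  rewrite hornerZ hornerXn mulrCA; congr (_ * _).
  by rewrite exprVn expfB_cond // (negbTE x0) ltnW ?ltn_ord.
have rev_big j : (n < j)%N -> rev`_j = 0.
  move=> nj; rewrite coef_sum big1 // => i _.
  by rewrite coefZ coefXn gtn_eqF ?mulr0 // (leq_ltn_trans (leq_subr _ _)).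
have revn : rev`_n = D'`_0.
  rewrite coef_sum; case: (posnP n) => [n0 | n0].
    rewrite big1 => [|i _]; last by have := leq_trans (ltn_ord i) (eq_leq n0).
    by rewrite nth_default // -/n n0.
  rewrite (bigD1 (Ordinal n0)) //= subn0 coefZ coefXn eqxx mulr1.
  rewrite big1 ?addr0 // => i; rewrite -val_eqE /= => i0.
  by rewrite coefZ coefXn gtn_eqF ?mulr0 //; have := ltn_ord i; lia.
have cD k : (2 * q <= k)%N -> D`_k = b * rev`_(n + k - 2 * q).
  move=> qk; have := congr1 (fun p : {poly F} => p`_(n + k)) revE.
  rewrite /= coefZ !coefXnM ltnNge leq_addr /= addKn => ->.
  by rewrite ltnNge (leq_trans qk (leq_addl _ _)).
exists D`_q => x.
rewrite [in LHS](_ : D = (D`_0)%:P + D`_q *: 'X^q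
  + (b * D'`_0) *: 'X^(2 * q)); last first.
  apply/polyP => k; rewrite !coefD coefC !coefZ !coefXn.
  case: (ltngtP k (2 * q)) => [k2q | k2q | ->].
  - case: (boolP (q %| k)%N) => [/dvdnP[j kj] | /[dup] nqk /cD0 ->].
      move: k2q; rewrite kj ltn_mul2r q0 /=.
      case: j {kj} => [|[|//]] _; rewrite ?mul0n ?mul1n.
        by rewrite eqxx ltn_eqF // !mulr0 !addr0.
      by rewrite eqxx (gtn_eqF q0) mulr1 mulr0 add0r addr0.
    have [k0 kq] : k != 0%N /\ k != q.
      by split; apply: contraNneq nqk => ->; rewrite ?dvdn0 ?dvdnn.
    by rewrite (negbTE k0) (negbTE kq) !mulr0 !addr0.
  - rewrite cD ?(ltnW k2q) // rev_big; last lia.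
    rewrite !gtn_eqF; [by rewrite !mulr0 !addr0 | lia | lia].
  - rewrite cD // addnK revn !gtn_eqF; [by rewrite mulr1 mulr0 !add0r | lia | lia].
by rewrite !hornerE !horner_coef0.
Qed.

(** * Determinants of three by three block matrices *)

Section BlockMatrices.
Variables (F : numFieldType) (q : nat).
Implicit Types (a c l x z : F) (X Y : 'M[F]_q).

Definition blk3 (M11 M12 M13 M21 M22 M23 M31 M32 M33 : 'M[F]_q) :
    'M[F]_(q + (q + q)) :=
  block_mx M11 (row_mx M12 M13) (col_mx M21 M31) (block_mx M22 M23 M32 M33).

Lemma mul_blk3 (A11 A12 A13 A21 A22 A23 A31 A32 A33
                B11 B12 B13 B21 B22 B23 B31 B32 B33 : 'M[F]_q) :
  blk3 A11 A12 A13 A21 A22 A23 A31 A32 A33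
    *m blk3 B11 B12 B13 B21 B22 B23 B31 B32 B33
  = blk3
      (A11 *m B11 + A12 *m B21 + A13 *m B31)
      (A11 *m B12 + A12 *m B22 + A13 *m B32)
      (A11 *m B13 + A12 *m B23 + A13 *m B33)
      (A21 *m B11 + A22 *m B21 + A23 *m B31)
      (A21 *m B12 + A22 *m B22 + A23 *m B32)
      (A21 *m B13 + A22 *m B23 + A23 *m B33)
      (A31 *m B11 + A32 *m B21 + A33 *m B31)
      (A31 *m B12 + A32 *m B22 + A33 *m B32)
      (A31 *m B13 + A32 *m B23 + A33 *m B33).
Proof.
rewrite /blk3 mulmx_block mul_row_col mul_mx_row mul_row_block add_row_mx.
rewrite mul_col_mx mul_block_col add_col_mx mul_col_row mulmx_block.
by rewrite add_block_mx !addrA.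
Qed.

Lemma det_blk3_diag (A B C : 'M[F]_q) :
  \det (blk3 A 0 0 0 B 0 0 0 C) = \det A * \det B * \det C.
Proof. by rewrite /blk3 row_mx0 col_mx0 det_ublock det_ublock mulrA. Qed.

Lemma det_conj n (T M M' : 'M[F]_n) :
  T \in unitmx -> T *m M = M' *m T -> \det M = \det M'.
Proof.
rewrite unitmxE unitfE => T0 /(congr1 determinant).
by rewrite !det_mulmx mulrC => /(mulIf T0).
Qed.

Lemma blk3_diag_unit (A B C : 'M[F]_q) :
  A \in unitmx -> B \in unitmx -> C \in unitmx ->
  blk3 A 0 0 0 B 0 0 0 C \in unitmx.
Proof.
rewrite !unitmxE det_blk3_diag !unitfE => A0 B0 C0.
by rewrite !mulf_neq0.
Qed.

(** The inverse E of the lower right block is an argument, so that an explicit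
    inverse can be supplied. *)
Lemma det_block_schur m n (A : 'M[F]_m) (B : 'M[F]_(m, n)) (C : 'M[F]_(n, m))
    (D E : 'M[F]_n) :
  D *m E = 1%:M -> \det (block_mx A B C D) = \det (A - B *m E *m C) * \det D.
Proof.
move=> DE; have ED : E *m D = 1%:M by apply: mulmx1C.
have -> : block_mx A B C D =
   block_mx 1%:M (B *m E) 0 1%:M *m block_mx (A - B *m E *m C) 0 C D.
  rewrite mulmx_block !(mul1mx, mul0mx, add0r) subrK.
  by rewrite -mulmxA ED mulmx1.
by rewrite det_mulmx det_ublock det_lblock !det1 !mul1r.
Qed.

Lemma det_scalar_corner l u v :
  \det (block_mx l%:M u%:M v%:M 0 : 'M[F]_(q + q)) = (- (u * v)) ^+ q.
Proof.
(* The last three factors multiply to the block swap, of determinant (-1)^q. *)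
have -> : (block_mx l%:M u%:M v%:M 0 : 'M[F]_(q + q)) =
  block_mx u%:M l%:M 0 v%:M *m block_mx 1%:M 1%:M 0 1%:M
    *m block_mx (-1)%:M 0 1%:M 1%:M *m block_mx 1%:M (-1)%:M 0 1%:M.
  rewrite !mulmx_block !(mul0mx, mulmx0, add0r, addr0).
  do 3 rewrite ?mulmx1 -?scalar_mxM -?raddfD /=.
  rewrite -[0 in LHS](raddf0 (@scalar_mx F q)).
  by congr block_mx; congr (_%:M); ring.
rewrite !det_mulmx !det_ublock det_lblock !det1 !det_scalar.
by rewrite !mulr1 -!exprMn; congr (_ ^+ q); ring.
Qed.

(** * The gauge-fixed kagome matrix *)

(** The kagome matrix minus l, after conjugation by diag(X, 1, Y^-1). The scalars a
    and c are arbitrary, so that replacing them by their inverses stays within the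
    family; this is what makes the symmetries below usable. *)
Definition hou_mx a c l X Y :=
  blk3 (- l)%:M (a *: (1%:M + c *: Y)) (a^-1 *: (X + Y))
       (a^-1 *: (1%:M + c^-1 *: invmx Y)) (- l)%:M (a *: (1%:M + c *: X))
       (a *: (invmx X + invmx Y)) (a^-1 *: (1%:M + c^-1 *: invmx X)) (- l)%:M.

(** Multiplying the last block row of the matrix above by X removes the inverse of X
    and leaves a matrix affine in X, which may be evaluated at X = 0. *)
Definition hou_pencil a c l X Y :=
  blk3 (- l)%:M (a *: (1%:M + c *: Y)) (a^-1 *: (X + Y))
       (a^-1 *: (1%:M + c^-1 *: invmx Y)) (- l)%:M (a *: (1%:M + c *: X))
       (a *: (1%:M + X *m invmx Y)) (a^-1 *: (X + c^-1%:M)) (- l *: X).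

(** The value l = - a^3 c - a^-3 c^-1 where this vanishes is the energy at which the
    dependence on the quasimomenta disappears. *)
Definition flat_factor a c l := l + a ^+ 3 * c + a^-1 ^+ 3 * c^-1.

Lemma det_pencil a c l X Y :
  X \in unitmx -> \det (hou_pencil a c l X Y) = \det X * \det (hou_mx a c l X Y).
Proof.
move=> Xu.
have -> : hou_pencil a c l X Y = blk3 1%:M 0 0 0 1%:M 0 0 0 X *m hou_mx a c l X Y.
  rewrite mul_blk3 !(mul0mx, addr0, add0r, mul1mx); congr blk3.
  - by rewrite -scalemxAr mulmxDr mulmxV.
  - by rewrite -scalemxAr mulmxDr -scalemxAr mulmxV // mulmx1 scalemx1.
  - by rewrite mul_mx_scalar.
by rewrite det_mulmx det_blk3_diag !det1 !mul1r.
Qed.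

(** Conjugation by diag(Y, Y, Y) fixes Y and multiplies X by z. *)
Lemma det_pencil_twist a c l z X Y :
  Y \in unitmx -> Y *m X = z *: (X *m Y) ->
  \det (hou_pencil a c l (z *: X) Y) = \det (hou_pencil a c l X Y).
Proof.
move=> Yu YX; have Tu := blk3_diag_unit Yu Yu Yu.
symmetry; apply: (det_conj Tu).
rewrite !mul_blk3 !(mul0mx, mulmx0, addr0, add0r) !scalar_mxC.
rewrite -!scalemxAl -!scalemxAr !(mulmxDl, mulmxDr, mul1mx, mulmx1).
rewrite -!scalemxAl -!scalemxAr YX scalar_mxC mulmxV // mulVmx //.
by rewrite mulmxA YX -!scalemxAl -!mulmxA mulmxV // mulVmx.
Qed.

(** At X = 0 the blocks commute. The lower right two by two corner is then a scalar
    matrix, independent of Y, and its Schur complement is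
    - c (l + a^3 c + a^-3 c^-1) (c^-1 + Y). *)
Lemma det_pencil0 a c l Y : a != 0 -> c != 0 -> Y \in unitmx ->
  \det (hou_pencil a c l 0 Y) = flat_factor a c l ^+ q * \det (c^-1%:M + Y).
Proof.
move=> a0 c0 Yu; have corner : block_mx (- l)%:M (a *: 1%:M) (a^-1 *: c^-1%:M) 0
    *m block_mx 0 (a * c)%:M a^-1%:M (l * c)%:M = 1%:M :> 'M[F]_(q + q).
  rewrite mulmx_block !(mul0mx, mulmx0, addr0, add0r) !scalemx1 !scale_scalar_mx.
  rewrite -!scalar_mxM -raddfD [RHS]scalar_mx_block /=.
  rewrite divff // (_ : - l * _ + _ = 0); last by ring.
  rewrite (_ : _ / c * _ = 1) ?raddf0 //.
  by field; rewrite a0 c0.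
rewrite /hou_pencil /blk3 mul0mx !scaler0 !addr0 !add0r.
rewrite (det_block_schur _ _ _ corner) mul_row_block mul_row_col.
rewrite scalemx1 scale_scalar_mx det_scalar_corner.
rewrite (_ : _ - _ = (- (flat_factor a c l * c)) *: (c^-1%:M + Y)); last first.
  rewrite !mul_mx_scalar !mulmxDl -!scalemxAl -!scalemxAr.
  rewrite !(mulmxDl, mulmxDr, mul1mx, mulmx1) -!scalemxAl -!scalemxAr mulmxV //.
  rewrite !(mulmx0, mul0mx, scaler0, addr0, add0r).
  apply/matrixP => i j; rewrite !mxE /flat_factor.
  by case: (i == j); rewrite ?mulr1n ?mulr0n; field; rewrite a0 c0.
rewrite detZ mulrAC -exprMn; congr (_ ^+ q * _).
by field; rewrite a0 c0.
Qed.

(** This exchanges the behaviours at X = 0 and at X = infinity. *)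
Lemma tr_hou a c l X Y :
  (hou_mx a c l X Y)^T = hou_mx a^-1 c^-1 l (invmx X)^T (invmx Y)^T.
Proof.
rewrite /hou_mx /blk3 tr_block_mx tr_row_mx tr_col_mx tr_block_mx.
rewrite !(linearZ, linearD) /= !trmx_inv !tr_scalar_mx !invmxK !invrK.
by rewrite !scalerDr !scalerA ![c^-1 * _]mulrC ![c * _]mulrC.
Qed.

(** The first and the third block play symmetric roles. *)
Lemma det_hou_flip a c l X Y :
  \det (hou_mx a c l X Y) = \det (hou_mx a^-1 c^-1 l (invmx Y) (invmx X)).
Proof.
have Tu : blk3 0 0 1%:M 0 1%:M 0 1%:M 0 0 \in unitmx.
  suff : blk3 0 0 1%:M 0 1%:M 0 1%:M 0 0 *m blk3 0 0 1%:M 0 1%:M 0 1%:M 0 0 = 1%:M.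
    by move/mulmx1_unit => [].
  rewrite mul_blk3 !(mul0mx, mulmx0, addr0, add0r, mulmx1) /blk3.
  by rewrite row_mx0 col_mx0 -!scalar_mx_block.
apply: (det_conj Tu).
rewrite !mul_blk3 !(mul0mx, mulmx0, addr0, add0r, mulmx1, mul1mx) !invmxK !invrK.
by rewrite [invmx Y + _]addrC [Y + _]addrC.
Qed.

End BlockMatrices.

(** * Determinants of Weyl pairs *)

Lemma det_affine_poly (F : comNzRingType) n (A B : 'M[F]_n) :
  exists D : {poly F}, forall x, D.[x] = \det (A + x *: B).
Proof.
exists (\det (map_mx polyC A + 'X *: map_mx polyC B)) => x.
rewrite -[LHS]/(horner_eval x _) -det_map_mx; congr determinant.
apply/matrixP => i j; rewrite !mxE /= /horner_eval.
by rewrite hornerD hornerM hornerX !hornerC.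
Qed.

Section WeylPairs.
Variables (F : numFieldType) (q : nat) (z : F).
Hypotheses (q_gt0 : (0 < q)%N) (zq : q.-primitive_root z).
Implicit Types (a c l x y : F) (X Y : 'M[F]_q).

Definition weyl_pair X Y :=
  [/\ X \in unitmx, Y \in unitmx & Y *m X = z *: (X *m Y)].

Lemma pencil_poly a c l X Y :
  exists D : {poly F}, forall x, D.[x] = \det (hou_pencil a c l (x *: X) Y).
Proof.
have [D DE] := det_affine_poly (hou_pencil a c l 0 Y)
  (blk3 0 0 (a^-1 *: X) 0 0 (a *: (c *: X))
        (a *: (X *m invmx Y)) (a^-1 *: X) (- l *: X)).
exists D => x; rewrite {}DE; congr (\det _).
rewrite /hou_pencil /blk3 !(scale_block_mx, scale_row_mx, scale_col_mx).
rewrite !(add_block_mx, add_row_mx, add_col_mx) !scaler0 !addr0 mul0mx !add0r.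
rewrite !(scalerDr, scalerA) -scalemxAl !scalerA.
rewrite !(mulrC x) scaler0 addr0 [a^-1 *: Y + _]addrC.
by rewrite [a^-1 *: c^-1%:M + _]addrC mulrA.
Qed.

(** The polynomials D and D' are the determinants of the pencil attached to X and of
    the one attached to the inverse transpose of X. They describe the determinant
    near x = 0 and near x = infinity, and both of their constant terms are given by
    the same computation at X = 0. *)
Lemma det_hou_expand a c l X Y :
  a != 0 -> c != 0 -> weyl_pair X Y ->
  exists m, forall x, x != 0 ->
    \det (hou_mx a c l (x *: X) Y)
    = m + flat_factor a c l ^+ q *
        (x ^+ q * \det X * \det (c%:M + invmx Y)
         + (x ^+ q * \det X)^-1 * \det (c^-1%:M + Y)).
Proof.
move=> a0 c0 [Xu Yu YX].
have [D DE] := pencil_poly a c l X Y.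
have [D' D'E] := pencil_poly a^-1 c^-1 l (invmx X)^T (invmx Y)^T.
have dX : \det X != 0 by rewrite -unitfE -unitmxE.
have xXu x : x != 0 -> x *: X \in unitmx.
  by move=> x0; rewrite unitmxE detZ unitfE mulf_neq0 ?expf_neq0.
have houE x : x != 0 ->
    D.[x] = x ^+ q * \det X * \det (hou_mx a c l (x *: X) Y).
  by move=> x0; rewrite DE det_pencil ?xXu // detZ.
have D'E' x : x != 0 ->
    D'.[x^-1] = (x ^+ q * \det X)^-1 * \det (hou_mx a c l (x *: X) Y).
  move=> x0; rewrite D'E.
  have -> : x^-1 *: (invmx X)^T = (invmx (x *: X))^T.
    by rewrite invmxZ ?xXu // linearZ.
  rewrite det_pencil; last by rewrite unitmx_tr unitmx_inv xXu.
  by rewrite -(tr_hou a c l (x *: X) Y) !det_tr det_inv detZ.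
have [m Dm] : exists m, forall x,
    D.[x] = D.[0] + m * x ^+ q + \det X ^+ 2 * D'.[0] * x ^+ (2 * q).
  apply: (three_term_laurent q_gt0 zq) => x x0.
    rewrite !DE -scalerA; apply: det_pencil_twist => //.
    by rewrite -scalemxAr YX -scalemxAl !scalerA mulrC.
  rewrite houE // D'E' // mulnC exprM.
  by field; rewrite dX expf_neq0.
exists (m / \det X) => x x0.
have xq0 : x ^+ q != 0 by rewrite expf_neq0.
apply: (@mulfI _ (x ^+ q * \det X)); first by rewrite mulf_neq0.
rewrite -houE // Dm DE D'E !scale0r !det_pencil0 ?invr_eq0 //; last first.
  by rewrite unitmx_tr unitmx_inv.
have -> : flat_factor a^-1 c^-1 l = flat_factor a c l.
  by rewrite /flat_factor !invrK addrAC.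
have -> : \det (c^-1^-1%:M + (invmx Y)^T) = \det (c%:M + invmx Y).
  by rewrite invrK -det_tr linearD /= tr_scalar_mx trmxK.
by rewrite mulnC exprM; field; rewrite dX xq0.
Qed.

(** Conjugation by X multiplies Y by a root of unity, so the characteristic polynomial
    of Y is rotation invariant and has only the degrees 0 and q. *)
Lemma det_shift Y X t : weyl_pair X Y -> \det (t%:M + Y) = t ^+ q + \det Y.
Proof.
move=> [Xu Yu YX]; pose P := char_poly (- Y).
have PE u : P.[u] = \det (u%:M + Y).
  rewrite -[LHS]/(horner_eval u _) -det_map_mx; congr determinant.
  apply/matrixP => i j; rewrite !mxE /= /horner_eval hornerD hornerMn hornerX.
  by rewrite hornerN hornerC opprK.
have zq1 : z ^+ q = 1 by apply: prim_expr_order.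
have coP : forall k, ~~ (q %| k)%N -> P`_k = 0.
  apply: (coef_rotation_invariant zq); apply: poly_eq_off0 => u _.
  rewrite horner_comp hornerZ hornerX !PE.
  rewrite -[RHS]mul1r -zq1 -detZ scalerDr scale_scalar_mx; symmetry.
  apply: (det_conj Xu); rewrite mulmxDl mulmxDr scalar_mxC YX.
  by rewrite scalemxAr.
have Pq : P`_q = 1.
  have := char_poly_monic (- Y).
  by rewrite monicE lead_coefE size_char_poly => /eqP.
have P0 : P`_0 = \det Y.
  by rewrite -horner_coef0 PE raddf0 add0r.
rewrite -PE horner_coef size_char_poly big_ord_recr /= Pq mul1r addrC.
congr (_ + _); rewrite (bigD1 (Ordinal q_gt0)) //= expr0 mulr1 P0.
rewrite big1 ?addr0 // => i; rewrite -val_eqE /= -lt0n => i0.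
rewrite coP ?mul0r //; apply/negP => /(dvdn_leq i0).
by rewrite leqNgt ltn_ord.
Qed.

End WeylPairs.

(** * Independence of the quasimomenta *)

(** For u = e^(i s) and v = e^(i t) this is twice cos s + cos t + cos (s - t). *)
Definition six_terms (F : fieldType) (u v : F) : F :=
  u + u^-1 + v + v^-1 + u / v + v / u.

Section KagomeConstant.
Variables (F : numFieldType) (q : nat) (z : F).
Hypotheses (q_gt0 : (0 < q)%N) (zq : q.-primitive_root z).
Implicit Types (a c l x y : F) (X Y : 'M[F]_q).

Lemma unitmx_scale x X : x != 0 -> (x *: X \in unitmx) = (X \in unitmx).
Proof.
by move=> x0; rewrite !unitmxE detZ unitrM unitfE expf_neq0.
Qed.

Lemma weyl_pair_scale x y X Y : x != 0 -> y != 0 ->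
  weyl_pair z X Y -> weyl_pair z (x *: X) (y *: Y).
Proof.
move=> x0 y0 [Xu Yu YX]; split; rewrite ?unitmx_scale //.
by rewrite -!scalemxAl -!scalemxAr YX !scalerA; congr (_ *: _); ring.
Qed.

Lemma weyl_pair_tr X Y : weyl_pair z X Y -> weyl_pair z Y^T X^T.
Proof.
move=> [Xu Yu YX]; split; rewrite ?unitmx_tr //.
by rewrite -!trmx_mul YX linearZ.
Qed.

Lemma weyl_pair_inv X Y : weyl_pair z X Y -> weyl_pair z (invmx X) (invmx Y).
Proof.
move=> [Xu Yu YX]; split; rewrite ?unitmx_inv //.
have YXV : Y *m X *m (invmx X *m invmx Y) = 1%:M.
  by rewrite mulmxA mulmxK // mulmxV.
rewrite -[LHS]mulmx1 -YXV YX -scalemxAl -scalemxAr; congr (_ *: _).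
by rewrite !mulmxA mulmxKV // mulVmx // mul1mx.
Qed.

(** Transposition and flip each replace a and c by their inverses, so that together
    they only exchange the two matrices; the transposed pair has the same z. *)
Lemma det_hou_swap a c l X Y :
  \det (hou_mx a c l X Y) = \det (hou_mx a c l Y^T X^T).
Proof.
by rewrite -[LHS]det_tr (tr_hou a c l X Y) [RHS]det_hou_flip !trmx_inv.
Qed.

(** The coefficients of x^q and x^-q found above are exactly the part of the six
    monomials that involves X. *)
Lemma det_hou_scale1 a c l x X Y :
  a != 0 -> c != 0 -> x != 0 -> weyl_pair z X Y ->
  \det (hou_mx a c l (x *: X) Y) - flat_factor a c l ^+ q *
     six_terms (c ^+ q * \det (x *: X)) (c ^+ q * \det Y)
  = \det (hou_mx a c l X Y) - flat_factor a c l ^+ q *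
     six_terms (c ^+ q * \det X) (c ^+ q * \det Y).
Proof.
move=> a0 c0 x0 W; have [Xu Yu _] := W.
have [m mE] := det_hou_expand q_gt0 zq l a0 c0 W.
have m1 := mE 1 (oner_neq0 _); rewrite scale1r in m1.
rewrite [\det (hou_mx a c l (x *: X) Y)](mE x x0) [\det (hou_mx a c l X Y)]m1.
rewrite !(det_shift q_gt0 zq _ (weyl_pair_inv W)) !(det_shift q_gt0 zq _ W).
rewrite det_inv !detZ /six_terms.
have dX : \det X != 0 by rewrite -unitfE -unitmxE.
have dY : \det Y != 0 by rewrite -unitfE -unitmxE.
rewrite expr1n exprVn.
have := expf_neq0 q x0; have := expf_neq0 q c0.
move: (x ^+ q) (c ^+ q) => xq cq cq0 xq0.
by field; rewrite dX dY cq0 xq0.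
Qed.

(** Independence of y follows from independence of x, because exchanging X and Y
    preserves both the determinant and the six monomials. *)
Lemma det_hou_six_terms a c l x y u v X Y :
  a != 0 -> c != 0 -> x != 0 -> y != 0 -> weyl_pair z X Y ->
  c ^+ q * \det X = u -> c ^+ q * \det Y = v ->
  \det (hou_mx a c l (x *: X) (y *: Y))
  = \det (hou_mx a c l X Y)
    + (six_terms (x ^+ q * u) (y ^+ q * v) - six_terms u v) * flat_factor a c l ^+ q.
Proof.
move=> a0 c0 x0 y0 W <- <-.
pose E X' Y' := \det (hou_mx a c l X' Y') - flat_factor a c l ^+ q *
  six_terms (c ^+ q * \det X') (c ^+ q * \det Y').
have Etr X' Y' : E X' Y' = E Y'^T X'^T.
  rewrite /E [\det (hou_mx a c l X' Y')]det_hou_swap !det_tr; congr (_ - _ * _).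
  by rewrite /six_terms; ring.
have W1 : weyl_pair z X (y *: Y).
  by rewrite -[X]scale1r; apply: weyl_pair_scale; rewrite ?oner_neq0.
suff : E (x *: X) (y *: Y) = E X Y.
  rewrite /E !detZ ![c ^+ q * (_ * _)]mulrCA => /eqP.
  by rewrite subr_eq => /eqP ->; ring.
have -> : E (x *: X) (y *: Y) = E X (y *: Y) by apply: det_hou_scale1.
rewrite Etr [RHS]Etr linearZ.
exact: (det_hou_scale1 l a0 c0 y0 (weyl_pair_tr W)).
Qed.

End KagomeConstant.

(** * Phases and the matrices J and K *)

Section Expi.
Variable R : realType.
Implicit Types (t u : R) (n : nat) (k : int).

Lemma expiD t u : expi (t + u) = expi t * expi u.
Proof. by rewrite /expi cosD sinD; simpc; rewrite [cos t * sin u + _]addrC. Qed.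

Lemma expi0 : expi 0 = 1 :> R[i].
Proof. by rewrite /expi cos0 sin0. Qed.

Lemma expi_neq0 t : expi t != 0.
Proof.
apply/eqP => t0; have := expi0; rewrite -(subrr t) expiD t0 mul0r => /eqP.
by rewrite eq_sym oner_eq0.
Qed.

Lemma expiN t : expi (- t) = (expi t)^-1.
Proof.
by apply: (mulfI (expi_neq0 t)); rewrite -expiD subrr expi0 divff ?expi_neq0.
Qed.

Lemma expi_conj t : Num.conj (expi t) = expi (- t).
Proof. by rewrite /expi cosN sinN. Qed.

Lemma expiMn n t : expi (n%:R * t) = expi t ^+ n.
Proof.
elim: n => [|n IH]; first by rewrite mul0r expi0.
by rewrite -addn1 natrD mulrDl mul1r expiD IH exprD.
Qed.

Lemma expi_addN t : expi t + expi (- t) = (2 * cos t)%:C.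
Proof. by apply/eqP; rewrite eq_complex /= cosN sinN subrr mulr_natl !eqxx. Qed.

Lemma expi_pi : expi pi = -1 :> R[i].
Proof. by rewrite /expi cospi sinpi; simpc. Qed.

Lemma expi_int_2pi k : expi (2 * pi * k%:~R) = 1 :> R[i].
Proof.
have e n : expi (2 * pi * n%:R) = 1 :> R[i].
  by rewrite mulrC expiMn mulr_natl mulr2n expiD expi_pi mulrNN mulr1 expr1n.
by case: k => n; rewrite ?NegzE ?mulrNz ?mulrN ?expiN e ?invr1.
Qed.

(** By the double angle formula, cos t = 1 would force sin (t / 2) = 0. *)
Lemma expi_neq1 t : 0 < t < 2 * pi -> expi t != 1.
Proof.
move=> /andP[t0 t2pi]; have : 0 < sin (t / 2) by apply: sin_gt0_pi; lra.
move=> s0; apply/eqP => -[cost _]; have := cos_mulr2n (t / 2).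
rewrite (_ : t / 2 *+ 2 = t) ?cost => [c2|]; last by field.
by have := cos2Dsin2 (t / 2); nra.
Qed.

Lemma expi_prim n : (0 < n)%N -> n.-primitive_root (expi (2 * pi / n%:R : R)).
Proof.
move=> n0; have n0R : n%:R != 0 :> R by rewrite pnatr_eq0 -lt0n.
rewrite /primitive_root_of_unity n0 /=; apply/forallP => i /=.
rewrite unity_rootE -expiMn.
case: (i.+1 =P n) (ltn_ord i) => [-> _ | /eqP ni iltn].
  by rewrite mulrC divfK // -[2 * pi]mulr1 (expi_int_2pi 1) eqxx.
rewrite (negbTE (expi_neq1 _)) //.
have nlt : (i.+1 < n)%N by rewrite ltn_neqAle ni.
have np : 0 < n%:R :> R by rewrite ltr0n.
have pi0 := pi_gt0 R; apply/andP; split.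
  by rewrite mulr_gt0 ?ltr0n // divr_gt0 // mulr_gt0.
by rewrite mulrA ltr_pdivrMr // [ltRHS]mulrC ltr_pM2r ?ltr_nat // mulr_gt0.
Qed.

(** Only p modulo q matters, which allows a natural number as exponent. *)
Lemma expi_flux_prim p n : (0 < n)%N -> coprimez p n%:Z ->
  n.-primitive_root (expi (flux R p n)).
Proof.
move=> n0 pn; have n0R : n%:R != 0 :> R by rewrite pnatr_eq0 -lt0n.
have n0Z : n%:Z != 0 by rewrite eqz_nat -lt0n.
have [r rE] : exists r : nat, (p %% n)%Z = r%:Z.
  by exists `|(p %% n)%Z|%N; rewrite gez0_abs // modz_ge0.
have -> : expi (flux R p n) = expi (2 * pi / n%:R) ^+ r.
  rewrite -expiMn {1}(divz_eq p n) rE /flux rmorphD rmorphM /=.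
  rewrite -[RHS]mul1r -(expi_int_2pi (p %/ n)%Z) -expiD; congr expi.
  by rewrite -!pmulrn; field.
rewrite prim_root_exp_coprime ?expi_prim //.
by move: pn; rewrite /coprimez -gcdz_modl rE.
Qed.

End Expi.

Section HarperMatrices.
Variables (R : realType) (p : int) (q : nat).
Hypotheses (q_gt0 : (0 < q)%N).
Local Notation g := (flux R p q).
Local Notation J := (Jmx R p q).
Local Notation K := (Kmx R q).

Lemma expi_flux_q : expi g ^+ q = 1.
Proof.
rewrite -expiMn /flux mulrC divfK ?pnatr_eq0 -?lt0n //.
exact: expi_int_2pi.
Qed.

Lemma Kmx_perm : K = perm_mx (perm (@ordS_inj q)).
Proof.
apply/matrixP => j k; rewrite !mxE permE -val_eqE /=.
by rewrite [(k %% q)%N]modn_small // eq_sym.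
Qed.

Lemma Kmx_unit : K \in unitmx.
Proof. by rewrite Kmx_perm unitmx_perm. Qed.

Lemma Kmx_adj : map_mx Num.conj K^T = invmx K.
Proof.
rewrite Kmx_perm tr_perm_mx map_perm_mx; set s := perm _.
rewrite -[LHS]mulmx1 -(mulmxV (unitmx_perm _ s)) mulmxA -perm_mxM.
by rewrite mulVg perm_mx1 mul1mx.
Qed.

Lemma Jmx_unit : J \in unitmx.
Proof.
rewrite unitmxE det_diag unitfE; apply/prodf_neq0 => i _.
by rewrite mxE expi_neq0.
Qed.

Lemma Jmx_adj : map_mx Num.conj J^T = invmx J.
Proof.
have JJ : map_mx Num.conj J^T *m J = 1%:M.
  rewrite tr_diag_mx map_diag_mx mulmx_diag -diag_const_mx; congr diag_mx.
  apply/rowP => i; rewrite !mxE.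
  by rewrite /= expi_conj -expiD addNr expi0.
by rewrite -[LHS]mulmx1 -(mulmxV Jmx_unit) mulmxA JJ mul1mx.
Qed.

Lemma weyl_pair_JK : weyl_pair (expi g) J K.
Proof.
split; [exact: Jmx_unit | exact: Kmx_unit |].
rewrite mul_mx_diag mul_diag_mx; apply/matrixP => j k; rewrite !mxE.
case: eqP => [kj | _]; last by rewrite mul0r !mulr0.
rewrite mul1r mulr1 !expiMn -(expr_mod k expi_flux_q) kj.
by rewrite (expr_mod _ expi_flux_q) exprS.
Qed.

Lemma expi_int_pi (k : int) : expi (k%:~R * pi) = (-1) ^+ `|k|%N :> R[i].
Proof.
case: k => n; first by rewrite -pmulrn expiMn expi_pi.
rewrite NegzE mulrNz mulNr expiN -pmulrn expiMn expi_pi abszN.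
by rewrite -exprVn invrN1.
Qed.

(** Evaluating det (t + K) = t^q + det K at t = -1 gives 0, because K fixes the
    constant vector. *)
Lemma det_Kmx (hpq : coprimez p q%:Z) : \det K = - (-1) ^+ q.
Proof.
have := det_shift q_gt0 (expi_flux_prim R q_gt0 hpq) (-1) weyl_pair_JK.
have -> : \det ((-1)%:M + K) = 0.
  apply/eqP/det0P; exists (const_mx 1).
    apply/eqP => /rowP/(_ (Ordinal q_gt0))/eqP.
    by rewrite !mxE oner_eq0.
  rewrite mulmxDr Kmx_perm -[perm _]invgK -col_permE mul_mx_scalar.
  by apply/rowP => i; rewrite !mxE mulr1 addNr.
by move/eqP; rewrite eq_sym addrC addr_eq0 => /eqP.
Qed.

(** The exponent on the left is (q - 2) p pi, equal to q p pi up to 2 p pi. *)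
Lemma phase_det_J :
  expi (- (g / 2)) ^+ q * \det J = expi (q%:R * (p%:~R * pi)).
Proof.
have -> : \det J = expi ((\sum_(j < q) j%:R) * g).
  rewrite det_diag mulr_suml (big_morph _ (@expiD R) (expi0 R)).
  by apply: eq_bigr => j _; rewrite mxE.
have sumE n : \sum_(j < n) j%:R = n%:R * (n%:R - 1) / 2 :> R.
  elim: n => [|n IH]; first by rewrite big_ord0 !mul0r.
  by rewrite big_ord_recr /= IH -addn1 natrD; field.
rewrite -expiMn -expiD -[RHS]mulr1 -(expi_int_2pi R (- p)) -expiD.
congr expi; rewrite sumE /flux mulrNz.
by field; rewrite pnatr_eq0 -lt0n.
Qed.

(** The two signs are (-1)^(p + q + 1) and (-1)^(p q), and (p - 1) (q - 1) is even as
    soon as p and q are not both even. *)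
Lemma phase_det_K (hpq : coprimez p q%:Z) :
  expi (- (g / 2)) ^+ q * \det K = expi (q%:R * (p%:~R * pi)).
Proof.
rewrite -expiMn det_Kmx // [RHS]expiMn.
have -> : q%:R * - (g / 2) = (- p)%:~R * pi.
  by rewrite /flux mulrNz; field; rewrite pnatr_eq0 -lt0n.
rewrite !expi_int_pi abszN -exprM.
have : ~~ (2 %| `|p|)%N || ~~ (2 %| q)%N.
  rewrite -negb_and -dvdn_gcd; apply: contraTN hpq => pq2.
  by rewrite coprimezE /coprime; apply: contraTneq pq2 => ->.
rewrite -signr_odd -[in X in _ * - X]signr_odd -[RHS]signr_odd oddM !dvdn2 !negbK.
by case: (odd _); case: (odd _) => //=;
  rewrite ?expr0 ?expr1 ?mulrN ?mulNr ?mul1r ?opprK.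
Qed.

End HarperMatrices.

(** * Hermitian matrices and the gauge transformation *)

Lemma blk3_sub_scalar (F : numFieldType) (q : nat) (l : F)
    (M11 M12 M13 M21 M22 M23 M31 M32 M33 : 'M[F]_q) :
  blk3 M11 M12 M13 M21 M22 M23 M31 M32 M33 - l%:M
  = blk3 (M11 - l%:M) M12 M13 M21 (M22 - l%:M) M23 M31 M32 (M33 - l%:M).
Proof.
rewrite /blk3 !scalar_mx_block !opp_block_mx !add_block_mx.
by rewrite !oppr0 !addr0.
Qed.

Section UnitaryGauge.
Variables (C : numClosedFieldType) (q : nat).
Implicit Types (a c l x y : C) (J K X Y : 'M[C]_q).

Lemma ctmxK m n (M : 'M[C]_(m, n)) : (M^t*)^t* = M.
Proof. by apply/matrixP => i j; rewrite !mxE conjCK. Qed.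

Lemma ctmxZ m n (k : C) (M : 'M[C]_(m, n)) : (k *: M)^t* = Num.conj k *: M^t*.
Proof. by rewrite linearZ /= map_mxZ. Qed.

Lemma ctmxD m n (M N : 'M[C]_(m, n)) : (M + N)^t* = M^t* + N^t*.
Proof. by rewrite linearD /= map_mxD. Qed.

Lemma ctmxM m n r (M : 'M[C]_(m, n)) (N : 'M[C]_(n, r)) :
  (M *m N)^t* = N^t* *m M^t*.
Proof. by rewrite trmx_mul map_mxM. Qed.

Definition hermitian3 (A B D : 'M[C]_q) : 'M[C]_(q + (q + q)) :=
  blk3 0 A B (A^t*) 0 D (B^t*) (D^t*) 0.

Lemma hermitian3_adj A B D : (hermitian3 A B D)^t* = hermitian3 A B D.
Proof.
rewrite /hermitian3 /blk3 !(tr_block_mx, tr_row_mx, tr_col_mx).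
rewrite !(map_block_mx, map_row_mx, map_col_mx) !ctmxK.
by rewrite !trmx0 !map_mx0.
Qed.

(** The gauge transformation diag(X, 1, Y^-1) absorbs X^-1 on the left of the first
    block row and Y^-1 on the right of the last block column. *)
Lemma det_hermitian3_hou a c l X Y :
  Num.conj a = a^-1 -> Num.conj c = c^-1 ->
  X \in unitmx -> Y \in unitmx -> X^t* = invmx X -> Y^t* = invmx Y ->
  \det (hermitian3 (a *: (invmx X + c *: (invmx X *m Y)))
                   (a^-1 *: (invmx X + invmx Y))
                   (a *: (c *: (X *m invmx Y) + invmx Y)) - l%:M)
  = \det (hou_mx a c l X Y).
Proof.
move=> a_adj c_adj Xu Yu X_adj Y_adj.
have aV_adj : Num.conj (a^-1) = a by rewrite -a_adj conjCK.
have XV_adj : (invmx X)^t* = X by rewrite -X_adj ctmxK.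
have YV_adj : (invmx Y)^t* = Y by rewrite -Y_adj ctmxK.
have Tu : blk3 X 0 0 0 1%:M 0 0 0 (invmx Y) \in unitmx.
  by apply: blk3_diag_unit; rewrite ?unitmx1 ?unitmx_inv.
apply: (det_conj Tu).
rewrite /hermitian3 !ctmxZ !ctmxD !ctmxZ !ctmxM.
rewrite a_adj aV_adj c_adj XV_adj YV_adj X_adj Y_adj.
rewrite blk3_sub_scalar !sub0r -raddfN /=.
rewrite /hou_mx !mul_blk3 !(mul0mx, mulmx0, addr0, add0r, mul1mx, mulmx1).
congr blk3.
- by rewrite scalar_mxC.
- by rewrite -scalemxAr mulmxDr -scalemxAr mulmxA mulmxV // mul1mx.
- by rewrite -scalemxAr -scalemxAl mulmxDr mulmxDl !mulmxV // addrC.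
- by rewrite -scalemxAl mulmxDl mul1mx -scalemxAl.
- by rewrite -scalemxAl mulmxDl mul1mx -scalemxAl addrC.
- by rewrite -scalemxAr -scalemxAl mulmxDr mulmxDl !mulVmx // addrC.
- rewrite -scalemxAr mulmxDr -scalemxAr mulmxA mulVmx // mul1mx.
  by rewrite addrC.
- by rewrite scalar_mxC.
Qed.

End UnitaryGauge.

(** Conjugating the entries amounts to transposing the matrix, which does not change
    the characteristic polynomial, so its coefficients are fixed by conjugation. *)
Lemma hermitian_char_poly (R : realType) n (M : 'M[R[i]]_n) :
  M^t* = M -> exists P : {poly R}, map_poly (real_complex R) P = char_poly M.
Proof.
move=> Mh; have conjM : map_mx Num.conj M = M^T.
  by rewrite -[in RHS]Mh map_trmx trmxK.
have char_tr : char_poly M^T = char_poly M.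
  rewrite /char_poly -[RHS]det_tr; congr determinant.
  by rewrite /char_poly_mx linearB /= tr_scalar_mx map_trmx.
have conjP : map_poly Num.conj (char_poly M) = char_poly M.
  by rewrite map_char_poly conjM.
exists (map_poly (@complex.Re R) (char_poly M)).
apply/polyP => k; rewrite !coef_map_id0 ?raddf0 //.
have : Num.conj (char_poly M)`_k = (char_poly M)`_k.
  by rewrite -[in RHS]conjP coef_map.
case: (_`_k) => r i /eqP; rewrite eq_complex /= => /andP[_ /eqP iN].
have -> : i = 0 by lra.
by [].
Qed.

(** * The kagome determinant *)

Section ScaledInverse.
Variables (F : numFieldType) (q : nat).
Implicit Types (a c x y : F) (J K : 'M[F]_q).

Lemma invmxZ_unit x J : x != 0 -> J \in unitmx ->
  invmx (x *: J) = x^-1 *: invmx J.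
Proof. by move=> x0 Ju; rewrite invmxZ ?unitmx_scale. Qed.

Lemma gaugeA a c x y J K : x != 0 -> J \in unitmx ->
  a *: (invmx (x *: J) + c *: (invmx (x *: J) *m (y *: K)))
  = a *: (x^-1 *: invmx J + (c * (x^-1 * y)) *: (invmx J *m K)).
Proof.
by move=> x0 Ju; rewrite invmxZ_unit // -scalemxAl -scalemxAr !scalerA mulrA.
Qed.

Lemma gaugeC a c x y J K : y != 0 -> K \in unitmx ->
  a *: (c *: ((x *: J) *m invmx (y *: K)) + invmx (y *: K))
  = a *: ((c * (x / y)) *: (J *m invmx K) + y^-1 *: invmx K).
Proof.
by move=> y0 Ku; rewrite invmxZ_unit // -scalemxAl -scalemxAr !scalerA mulrA.
Qed.

End ScaledInverse.

Section KagomeDeterminant.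
Variables (R : realType) (p : int) (q : nat).
Hypothesis q_gt0 : (0 < q)%N.
Local Notation g := (flux R p q).
Local Notation J := (Jmx R p q).
Local Notation K := (Kmx R q).

Lemma kagomeAE th1 th2 w : kagomeA p q th1 th2 w =
  expi (w + g / 8) *: (invmx (expi th1 *: J)
    + expi (- (g / 2)) *: (invmx (expi th1 *: J) *m (expi th2 *: K))).
Proof.
have e : expi (- (th1 - th2)) = (expi th1)^-1 * expi th2.
  by rewrite opprB addrC expiD expiN.
rewrite /kagomeA e (expiN th1) Jmx_adj [RHS]gaugeA //; first exact: expi_neq0.
exact: Jmx_unit.
Qed.

Lemma kagomeBE th1 th2 w : kagomeB p q th1 th2 w =
  (expi (w + g / 8))^-1 *: (invmx (expi th1 *: J) + invmx (expi th2 *: K)).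
Proof.
rewrite /kagomeB Jmx_adj Kmx_adj (expiN th1) (expiN th2) (expiN (w + _)).
by rewrite !invmxZ_unit ?expi_neq0 ?Jmx_unit ?Kmx_unit.
Qed.

Lemma kagomeCE th1 th2 w : kagomeC p q th1 th2 w =
  expi (w + g / 8) *: (expi (- (g / 2)) *:
    ((expi th1 *: J) *m invmx (expi th2 *: K)) + invmx (expi th2 *: K)).
Proof.
have e : expi (th1 - th2) = expi th1 / expi th2 by rewrite expiD expiN.
rewrite /kagomeC e (expiN th2) Kmx_adj [RHS]gaugeC //; first exact: expi_neq0.
exact: Kmx_unit.
Qed.

Lemma det_kagome_hou th1 th2 w l :
  kagome_char p q th1 th2 w l
  = \det (hou_mx (expi (w + g / 8)) (expi (- (g / 2))) l
              (expi th1 *: J) (expi th2 *: K)).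
Proof.
have [x0 y0] := (expi_neq0 th1, expi_neq0 th2).
rewrite -det_hermitian3_hou.
- by rewrite -kagomeAE -kagomeBE -kagomeCE.
- by rewrite expi_conj expiN.
- by rewrite expi_conj expiN.
- by rewrite unitmx_scale ?Jmx_unit.
- by rewrite unitmx_scale ?Kmx_unit.
- by rewrite ctmxZ Jmx_adj expi_conj expiN invmxZ_unit ?Jmx_unit.
- by rewrite ctmxZ Kmx_adj expi_conj expiN invmxZ_unit ?Kmx_unit.
Qed.

Lemma flat_expi w l :
  flat_factor (expi (w + g / 8)) (expi (- (g / 2))) l
  = l + (2 * cos (3 * w - g / 8))%:C.
Proof.
rewrite /flat_factor -expi_addN addrA -!expiN -!expiMn -!expiD.
by congr (_ + expi _ + expi _); field.
Qed.

Lemma six_terms_expi (s t : R) :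
  six_terms (expi s) (expi t) = (2 * ptri s t)%:C.
Proof.
rewrite /six_terms /ptri !mulrDr !rmorphD /= -!expi_addN opprB !expiD !expiN.
by ring.
Qed.

(** The reference point is th1 = th2 = 0, where the sum of cosines is 3 or -1 and has
    to be subtracted. *)
Lemma kagome_char_shift (hpq : coprimez p q%:Z) th1 th2 w l :
  let tri t1 t2 :=
    (2 * ptri (q%:R * (t1 + p%:~R * pi)) (q%:R * (t2 + p%:~R * pi)))%:C in
  kagome_char p q th1 th2 w l
  = kagome_char p q 0 0 w l +
    (tri th1 th2 - tri 0 0) * (l + (2 * cos (3 * w - g / 8))%:C) ^+ q.
Proof.
move=> tri.
have phase (t : R) : expi t ^+ q * expi (q%:R * (p%:~R * pi))
    = expi (q%:R * (t + p%:~R * pi)).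
  by rewrite -expiMn -expiD -mulrDr.
rewrite !det_kagome_hou expi0 !scale1r.
have zq := expi_flux_prim R q_gt0 hpq.
have a0 := expi_neq0 (w + g / 8).
have c0 := expi_neq0 (- (g / 2)).
have x0 := expi_neq0 th1.
have y0 := expi_neq0 th2.
have dJ := phase_det_J R p q_gt0.
have dK := phase_det_K R q_gt0 hpq.
have W := weyl_pair_JK R p q_gt0.
apply: (etrans (det_hou_six_terms q_gt0 zq l a0 c0 x0 y0 W dJ dK)).
by rewrite !phase !six_terms_expi flat_expi /tri !add0r.
Qed.

End KagomeDeterminant.

Lemma det_sub_scalar (F : comNzRingType) n (M : 'M[F]_n) l :
  \det (M - l%:M) = (-1) ^+ n * (char_poly M).[l].
Proof.
rewrite -[_.[l]]/(horner_eval l _) -det_map_mx -detZ; congr determinant.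
apply/matrixP => i j; rewrite !mxE /= /horner_eval !hornerE hornerMn hornerX.
by rewrite mulN1r opprB.
Qed.

Theorem theorem1p2 (R : realType) (p : int) (q : nat) (hq : (0 < q)%N)
    (hpq : coprimez p q%:Z) (w : R) :
  exists Q : {poly R},
    [/\ size Q = (3 * q).+1,
        lead_coef Q = (-1) ^+ q
      & forall (th1 th2 : R) (l : R[i]),
          kagome_char p q th1 th2 w l
          = (map_poly (real_complex R) Q).[l]
            + (2 * ptri (q%:R * (th1 + p%:~R * pi)) (q%:R * (th2 + p%:~R * pi)))%:C
              * (l + (2 * cos (3 * w - flux R p q / 8))%:C) ^+ q].
Proof.
have [P PE] := hermitian_char_poly (hermitian3_adj (kagomeA p q 0 0 w)
  (kagomeB p q 0 0 w) (kagomeC p q 0 0 w)).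
have sizeP : size P = (3 * q).+1.
  by rewrite -(size_map_poly (real_complex R)) PE size_char_poly; congr _.+1; lia.
have leadP : lead_coef P = 1.
  apply: (fmorph_inj (real_complex R)).
  rewrite -lead_coef_map PE rmorph1; apply/eqP.
  by rewrite -monicE char_poly_monic.
(* S removes the trigonometric part from the value at th1 = th2 = 0. *)
pose k := 2 * cos (3 * w - flux R p q / 8).
pose t := 2 * ptri (q%:R * (0 + p%:~R * pi)) (q%:R * (0 + p%:~R * pi)) : R.
pose S := (- t) *: ('X - (- k)%:P) ^+ q.
have sizeS : (size S < size ((-1) ^+ q *: P))%N.
  rewrite [ltnRHS]size_scale ?signr_eq0 // sizeP ltnS.
  by apply: leq_trans (size_scale_leq _ _) _; rewrite size_exp_XsubC; lia.
exists ((-1) ^+ q *: P + S); split.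
- by rewrite size_polyDl // size_scale ?signr_eq0.
- by rewrite lead_coefDl // lead_coefZ leadP mulr1.
move=> th1 th2 l; rewrite (kagome_char_shift hq hpq).
have -> : kagome_char p q 0 0 w l = (-1) ^+ q * (map_poly (real_complex R) P).[l].
  rewrite PE; apply: (etrans (det_sub_scalar _ l)); congr (_ * _).
  by rewrite exprD addnn -[RHS]mulr1 -muln2 exprM sqrr_sign.
have -> : map_poly (real_complex R) ((-1) ^+ q *: P + S)
    = (-1) ^+ q *: map_poly (real_complex R) P + (- t%:C) *: ('X + k%:C%:P) ^+ q.
  rewrite rmorphD /= !map_polyZ /= rmorph_sign rmorphN /=.
  rewrite [map_poly _ (_ ^+ q)]rmorphXn rmorphB /= map_polyX map_polyC /=.
  by rewrite !rmorphN /= opprK.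
by rewrite -/t -/k !hornerE; ring.
Qed.
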